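(* Let $m\ge3$ be an odd integer and let $\ell$ be a distance magic labeling of $C_m\square C_{2m}$ with $\ell_{0,0}=1$, and let $L$ be its $m\times 2m$ table. Then there exists an admissible pair $\langle\mathbf{a},\mathbf{b}\rangle$ such that $re(L)=\mathcal{T}(\mathbf{a},\frac{m-1}{2})+\mathcal{T}(\mathbf{b},\frac{m+1}{2})$ (equivalently, $L = ex\big(\mathcal{T}(\mathbf{a},\frac{m-1}{2})+\mathcal{T}(\mathbf{b},\frac{m+1}{2})\big)$). Moreover, this admissible pair of sequences is uniquely determined by $\ell$.
   Context: $\mathcal{N}_N=\{1-N,3-N,\ldots,N-1\}$. A distance magic labeling of a graph of order $N$ is a bijection $\ell:V\to\mathcal{N}_N$ such that every vertex has neighbour-label sum $0$. $C_m\square C_{2m}$ is the Cayley graph of $\mathbb{Z}_m\times\mathbb{Z}_{2m}$ with connection set $\{\pm(1,0),\pm(0,1)\}$; a labeling is represented by the $m\times 2m$ table $L=[\ell_{i,j}]$, $\ell_{i,j}=\ell((i,j))$, first index modulo $m$, second modulo $2m$. $re(L)$ is the $m\times m$ table $[t_{i,j}]$ with $t_{i,j}=\ell_{i,2j}$; for an $m\times m$ table $T$, $ex(T)$ is the $m\times 2m$ table with $(i,j)$ entry $t_{i,j/2}$ for $j$ even and $-t_{i,(j+m)/2}$ for $j$ odd. For a sequence $R=[r_0,\ldots,r_{m-1}]$ and $s\in\{0,\ldots,m-1\}$, $\mathcal{T}(R,s)$ is the $m\times m$ table with $(i,j)$ entry $r_{j-si}$ (index mod $m$); tables are added entrywise.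 A pair $\langle[a_0,\ldots,a_{m-1}],[b_0,\ldots,b_{m-1}]\rangle$ is admissible if all $a_i$ are odd integers in $\{1-2m^2,\ldots,2m^2-1\}$, all $b_i$ are even integers in $\{-2m^2,\ldots,2m^2-2\}$, $a_0=1$, $b_0=0$, and $\{x(a_i+b_j):x\in\{-1,1\},0\le i,j<m\}=\mathcal{N}_{2m^2}$. *)

(* Defs.v *)
From HB Require Import structures.
From mathcomp Require Export all_boot all_order all_algebra.

Set Implicit Arguments.
Unset Strict Implicit.
Unset Printing Implicit Defensive.

Import Order.TTheory GRing.Theory Num.Theory.

Local Open Scope ring_scope.

(* {1 - N, 3 - N, ..., N - 1} *)
Definition labels (N : nat) : seq int :=
  [seq 1 - N%:Z + (2 * k)%N%:Z | k <- iota 0 N].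

Definition cayley (G : zmodType) (S : seq G) : rel G :=
  [rel x y | y - x \in S].

(* C_m [] C_n as a Cayley graph of Z_m x Z_n; since 'Z_0 and 'Z_1 both denote
   Z/2Z, this is only meaningful for m, n > 1. *)
Definition torus (m n : nat) : rel ('Z_m * 'Z_n)%type :=
  @cayley ('Z_m * 'Z_n)%type [:: (1, 0); (-1, 0); (0, 1); (0, -1)].
Arguments torus : clear implicits.

Definition distance_magic (V : finType) (adj : rel V) (ell : V -> int) : Prop :=
  [/\ injective ell,
      codom ell =i labels #|V|
    & forall v : V, \sum_(u | adj v u) ell u = 0].

(* m x n tables with rows indexed modulo m and columns indexed modulo n. *)
Notation table m n := 'M[int]_((Zp_trunc m).+2, (Zp_trunc n).+2).

Definition label_table (m n : nat) (ell : 'Z_m * 'Z_n -> int) : table m n :=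
  \matrix_(i, j) ell (i, j).

(* Below, j : 'Z_n used as a nat denotes its representative in 0, ..., n - 1,
   and k%:R : 'Z_n is the class of k modulo n. *)

Definition re (m : nat) (L : table m (2 * m)) : table m m :=
  \matrix_(i, j) L i (2 * j)%N%:R.

Definition ex_table (m : nat) (T : table m m) : table m (2 * m) :=
  \matrix_(i, j) if odd j then - T i ((j + m)./2)%:R else T i (j./2)%:R.

Definition circ (m : nat) (R : {ffun 'Z_m -> int}) (s : nat) : table m m :=
  \matrix_(i, j) R ((j : 'Z_m) - s%:R * i).

Definition admissible (m : nat) (a b : {ffun 'Z_m -> int}) : Prop :=
  let N : int := (2 * m ^ 2)%N%:Z in
  [/\ forall i : 'Z_m, ~~ (2 %| a i)%Z /\ 1 - N <= a i <= N - 1,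
      forall i : 'Z_m, (2 %| b i)%Z /\ - N <= b i <= N - 2,
      a 0 = 1, b 0 = 0
    & forall z : int,
        z \in labels (2 * m ^ 2) <->
        exists x : int, exists i j : 'Z_m,
          (x = -1 \/ x = 1) /\ z = x * (a i + b j)].

(* Main.v *)
Require Import Defs.
From mathcomp Require Import all_boot all_order all_algebra.
From mathcomp Require Import zify ring lra.

Set Implicit Arguments.
Unset Strict Implicit.
Unset Printing Implicit Defensive.

Import Order.TTheory GRing.Theory Num.Theory.

Local Open Scope ring_scope.

(** Up to the sign [(-1)^j], the magic condition at [(i, j)] is the discrete
    wave equation.  In the diagonal coordinates [(u - v, u + v)] it says that
    the mixed difference of the signed labeling [G u v] vanishes, so [G] splits
    as a function of [u] plus a function of [v].  Shifting [u] or [v] by [m]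
    moves the vertex in the same way, so it changes [G] by a constant, which is
    [0] because [G] has period [2m]; as [m] is odd, this is
    [ell (i, j + m) = - ell (i, j)].  The two summands of [G], normalised at
    [0], are the sequences [a] and [b]. *)

Lemma mem_labels_double (N : nat) (z : int) :
  z \in labels N.*2 -> ~~ (2 %| z)%Z /\ 1 - N.*2%:Z <= z <= N.*2%:Z - 1.
Proof. by case/mapP=> k; rewrite mem_iota => Hk ->; split; lia. Qed.

Lemma mixed_diff0_split (G : nat -> nat -> int) :
    (forall u v, G u.+1 v.+1 + G u v = G u.+1 v + G u v.+1) ->
  forall u v, G u v + G 0 0 = G u 0 + G 0 v.
Proof.
move=> G_mixed u v.
have Gv x y : G x.+1 y + G x 0 = G x.+1 0 + G x y.
  by elim: y => [|y IHy] //; have := G_mixed x y; lia.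
by elim: u => [|u IHu]; [exact: addrC | have := Gv u v; lia].
Qed.

(** For a split [G], the change under [u + m] depends on [u] alone and the change under [v + m] on
    [v] alone; being equal, they are one constant [c], and two shifts give [2c = 0]. *)
Lemma mixed_diff0_period (G : nat -> nat -> int) m :
    (forall u v, G u.+1 v.+1 + G u v = G u.+1 v + G u v.+1) ->
    (forall u v, G (u + m)%N v = G u (v + m)%N) ->
    (forall u v, G (u + m + m)%N v = G u v) ->
  forall u v, G (u + m)%N v = G u v.
Proof.
move=> /mixed_diff0_split G_split Gsh Gper u v.
have := G_split (u + m)%N v; have := G_split u v.
have := G_split u m; have := G_split (u + m)%N m.
have := Gsh u 0%N; have := Gsh (u + m)%N 0%N; have := Gper u 0%N.
by rewrite !add0n; lra.
Qed.

(** * Neighbour sums in the torus *)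

Lemma Zp_oneN_neq m : (2 < m)%N -> (1 : 'Z_m) != -1.
Proof.
move=> m_gt2; rewrite -subr_eq0 opprK -[1 + 1]/(2%:R).
apply/eqP=> /(congr1 (fun x : 'Z_m => x : nat)).
by rewrite val_Zp_nat ?modn_small //; lia.
Qed.

(** Moduli above [2] make the four steps distinct, so no neighbour is counted once for two steps. *)
Lemma torus_sum m n (ell : 'Z_m * 'Z_n -> int) (x : 'Z_m) (y : 'Z_n) :
    (2 < m)%N -> (2 < n)%N ->
  \sum_(w | torus m n (x, y) w) ell w
    = ell (x + 1, y) + ell (x - 1, y) + ell (x, y + 1) + ell (x, y - 1).
Proof.
move=> m_gt2 n_gt2.
pose S : seq ('Z_m * 'Z_n) := [:: (1, 0); (-1, 0); (0, 1); (0, -1)].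
have S_uniq : uniq S.
  rewrite /= !inE !xpair_eqE !eqxx !(negbTE (Zp_oneN_neq _)) //=.
  by rewrite ?oppr_eq0 ?(eq_sym 0) ?oppr_eq0 ?oner_eq0 ?andbF.
rewrite (reindex (fun w : 'Z_m * 'Z_n => w + (x, y))) /=; last first.
  by exists (fun w : 'Z_m * 'Z_n => w - (x, y)) => w _; rewrite ?addrK ?subrK.
rewrite (eq_bigl (mem S)); last by move=> w /=; rewrite /torus /cayley /= addrK.
rewrite -big_uniq //= !big_cons big_nil addr0 !addrA.
have addE a b : (a, b) + (x, y) = (a + x, b + y) by [].
by rewrite !addE !add0r ![x + _]addrC ![y + _]addrC.
Qed.

(** * The labeling in diagonal coordinates *)

(** [u] and [v] are naturals because the sign is not a function of their residues modulo an odd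
    [m]. *)
Definition diag_label m (ell : 'Z_m * 'Z_(2 * m) -> int)
    (x : 'Z_m) (y : 'Z_(2 * m)) (u v : nat) : int :=
  (-1) ^+ (u + v) * ell (x + u%:R - v%:R, y + (u + v)%:R).

Section MagicTorus.

Variables (m : nat) (ell : 'Z_m * 'Z_(2 * m) -> int).

Lemma diag_label_mixed x y :
    (3 <= m)%N -> distance_magic (torus m (2 * m)) ell ->
  forall u v, diag_label ell x y u.+1 v.+1 + diag_label ell x y u v
            = diag_label ell x y u.+1 v + diag_label ell x y u v.+1.
Proof.
move=> m_ge3 [_ _ magic] u v.
(* The four neighbours of this vertex are the corners of the unit square at [(u, v)]. *)
have := magic (x + u%:R - v%:R, y + (u + v).+1%:R).
rewrite torus_sum //; last by lia.
rewrite /diag_label !addSn !addnS !exprS.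
have -> : x + u.+1%:R - v.+1%:R = x + u%:R - v%:R by ring.
have -> : x + u.+1%:R - v%:R = x + u%:R - v%:R + 1 by ring.
have -> : x + u%:R - v.+1%:R = x + u%:R - v%:R - 1 by ring.
have -> : y + (u + v).+2%:R = y + (u + v).+1%:R + 1 by ring.
have -> : y + (u + v).+1%:R - 1 = y + (u + v)%:R by ring.
move/(congr1 (fun t => (-1) ^+ (u + v) * t)); rewrite mulr0 => sum0.
by apply/eqP; rewrite -subr_eq0 -sum0; apply/eqP; ring.
Qed.

Hypotheses (m_ge3 : (3 <= m)%N) (m_odd : odd m).
Hypothesis ell_magic : distance_magic (torus m (2 * m)) ell.

Let m_gt1 : (1 < m)%N. Proof. by lia. Qed.
Let m2_gt1 : (1 < 2 * m)%N. Proof. by lia. Qed.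
Let mZ0 : m%:R = 0 :> 'Z_m. Proof. exact: pchar_Zp. Qed.
Let m2Z0 : m%:R + m%:R = 0 :> 'Z_(2 * m).
Proof. by rewrite -natrD addnn -mul2n pchar_Zp. Qed.

Lemma diag_label_shift x y u v :
  diag_label ell x y (u + m) v = diag_label ell x y u (v + m).
Proof.
rewrite /diag_label (_ : u + m + v = u + (v + m))%N; last by lia.
by rewrite !natrD mZ0 !addr0.
Qed.

Lemma diag_labelD x y u v :
  diag_label ell x y (u + m) v = diag_label ell x y u v.
Proof.
have mixed := diag_label_mixed x y m_ge3 ell_magic.
apply: (mixed_diff0_period mixed (diag_label_shift x y)).
move=> {}u {}v; rewrite /diag_label; congr (_ * ell (_, _)).
- by rewrite -signr_odd -[RHS]signr_odd; congr (_ ^+ _); lia.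
- by rewrite !natrD mZ0 !addr0.
- by rewrite -[RHS]addr0 -m2Z0; ring.
Qed.

(** The shift by [m] from the base point moves the vertex by [(0, m)] and flips the sign, as [m] is
    odd. *)
Lemma ell_antiperiod x y : ell (x, y + m%:R) = - ell (x, y).
Proof.
have := diag_labelD x y 0 0; rewrite /diag_label !addn0 mZ0 !subr0 !addr0.
by rewrite -signr_odd m_odd expr1 mulN1r mul1r => <-; rewrite opprK.
Qed.

Lemma ell_antiperiodMn k x y : ell (x, y + (k * m)%:R) = (-1) ^+ k * ell (x, y).
Proof.
elim: k => [|k IHk]; first by rewrite mul0n addr0 mul1r.
by rewrite (mulSnr k m) natrD addrA ell_antiperiod IHk exprS mulN1r mulNr.
Qed.

Lemma diag_label_mod u v :
  diag_label ell 0 0 (u %% m) (v %% m) = diag_label ell 0 0 u v.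
Proof.
have modl w t : diag_label ell 0 0 (w %% m) t = diag_label ell 0 0 w t.
  rewrite {2}(divn_eq w m); elim: (w %/ m)%N => [|k IHk] //.
  by rewrite (mulSnr k m) addnAC diag_labelD.
rewrite modl {2}(divn_eq v m); elim: (v %/ m)%N => [|k IHk] //.
by rewrite (mulSnr k m) addnAC -diag_label_shift diag_labelD.
Qed.

(* [(m + 1) / 2] and [(m - 1) / 2] are [1/2] and [-1/2] modulo [m]: this solves
   [u - v = i], [u + v = 2 j] up to a multiple of [m]. *)
Lemma ell_even_diag (i j : nat) :
  ell (i%:R, (2 * j)%:R)
    = diag_label ell 0 0 (j + (m + 1) %/ 2 * i) (j + (m - 1) %/ 2 * i).
Proof.
have -> : ((m + 1) %/ 2 = ((m - 1) %/ 2).+1)%N by lia.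
have Em : ((m - 1) %/ 2 * 2 + 1 = m)%N by lia.
set s := ((m - 1) %/ 2)%N in Em *.
have Euv : (j + s.+1 * i + (j + s * i) = 2 * j + i * m)%N by rewrite -Em; ring.
rewrite /diag_label Euv !add0r (natrD _ (2 * j)).
have -> : (j + s.+1 * i)%:R - (j + s * i)%:R = i%:R :> 'Z_m by ring.
(* The multiple [i * m] contributes [(-1) ^+ i]; the total sign is trivial because [i * (m + 1)] is
   even. *)
rewrite ell_antiperiodMn mulrA -exprD -signr_odd.
by rewrite (_ : odd _ = false) ?mul1r //; nia.
Qed.

Lemma diag_label_split u v :
  diag_label ell 0 0 u v
    = diag_label ell 0 0 u 0 + diag_label ell 0 0 0 v - ell (0, 0).
Proof.
have := mixed_diff0_split (diag_label_mixed 0 0 m_ge3 ell_magic) u v.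
move/(canRL (addrK _)) => ->; congr (_ - _).
by rewrite /diag_label addn0 subr0 !addr0 mul1r.
Qed.

Lemma codom_ell : codom ell =i labels (m ^ 2).*2.
Proof.
have [_ im _] := ell_magic; move=> z; rewrite im; congr (z \in labels _).
by rewrite card_prod !card_ord !Zp_cast //; lia.
Qed.

Lemma ell_mem_labels w : ell w \in labels (m ^ 2).*2.
Proof. by rewrite -codom_ell codom_f. Qed.

Definition diag_a : {ffun 'Z_m -> int} :=
  [ffun k : 'Z_m => diag_label ell 0 0 k 0].
Definition diag_b : {ffun 'Z_m -> int} :=
  [ffun k : 'Z_m => diag_label ell 0 0 0 k - ell (0, 0)].

Lemma diag_abD (i j : 'Z_m) : diag_a i + diag_b j = diag_label ell 0 0 i j.
Proof. by rewrite !ffunE addrA -diag_label_split. Qed.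

Lemma ell_even_ab (i j : 'Z_m) :
  ell (i, (2 * j)%N%:R)
    = diag_a (j - ((m - 1) %/ 2)%:R * i) + diag_b (j - ((m + 1) %/ 2)%:R * i).
Proof.
(* Modulo [m], [-s] is [t]: the shift [(m - 1) / 2] in [circ] thus matches [(m + 1) / 2] in
   [ell_even_diag], and conversely. *)
have shiftE s t : (s + t = m)%N -> j - s%:R * i = (j + t * i)%N%:R.
  move=> st; rewrite natrD natrM !natr_Zp; apply/eqP.
  by rewrite subr_eq -addrA -mulrDl -natrD addnC st mZ0 mul0r addr0.
rewrite -{1}[i]natr_Zp ell_even_diag diag_abD.
rewrite (shiftE _ ((m + 1) %/ 2)%N); last by lia.
rewrite (shiftE _ ((m - 1) %/ 2)%N); last by lia.
by rewrite !val_Zp_nat // diag_label_mod.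
Qed.

Lemma re_label_table :
  re (label_table ell)
    = circ diag_a ((m - 1) %/ 2) + circ diag_b ((m + 1) %/ 2).
Proof. by apply/matrixP=> i j; rewrite !mxE ell_even_ab. Qed.

(** An odd column [j] is the negative of column [j + m], whose index is even. *)
Lemma ex_re_label_table : ex_table (re (label_table ell)) = label_table ell.
Proof.
apply/matrixP=> i j; rewrite !mxE.
have jlt : (j < 2 * m)%N by have := ltn_ord j; rewrite [X in (_ < X)%N]Zp_cast.
have [jodd|jev] := ifPn.
  rewrite -[RHS]opprK -(ell_antiperiod i j) val_Zp_nat //.
  congr (- ell (_, _)); rewrite -[in RHS](natr_Zp j) -natrD.
  (* Doubling a residue modulo [m] is well defined modulo [2 * m]. *)
  by rewrite muln_modr Zp_nat_mod //; congr _%:R; lia.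
rewrite val_Zp_nat // -[in RHS](natr_Zp j).
by congr (ell (_, _%:R)); rewrite modn_small; lia.
Qed.

Lemma diag_admissible : ell (0, 0) = 1 -> admissible diag_a diag_b.
Proof.
move=> ell1.
have oppE x y : - ell (x, y) = ell (x, y + m%:R) by rewrite ell_antiperiod.
(* The sign is absorbed by antiperiodicity, so signed labels are labels again. *)
have diagL u v : exists w, diag_label ell 0 0 u v = ell w.
  rewrite /diag_label -signr_odd; case: odd; last by rewrite mul1r; eexists.
  by rewrite mulN1r oppE; eexists.
rewrite /admissible mul2n; split.
- move=> i; rewrite ffunE; have [w ->] := diagL i 0%N.
  exact: mem_labels_double (ell_mem_labels w).
- move=> i; rewrite ffunE; have [w ->] := diagL 0%N i.
  by have := mem_labels_double (ell_mem_labels w); rewrite ell1; lia.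
- by rewrite ffunE /diag_label !addr0 subr0 mul1r.
- by rewrite ffunE /diag_label !addr0 subr0 mul1r subrr.
move=> z; split=> [|[x [i [j [Hx ->]]]]]; last first.
  rewrite diag_abD; have [[w1 w2] ->] := diagL i j.
  by case: Hx => ->; rewrite ?mulN1r ?mul1r ?oppE ell_mem_labels.
rewrite -codom_ell => /codomP[[i j] ->].
(* The parity of the column decides the sign [x]. *)
have := congr1 (fun A : table m (2 * m) => A i j) ex_re_label_table.
rewrite !mxE => <-; case: odd; rewrite ell_even_ab.
  by exists (-1); do 2!eexists; rewrite mulN1r; split; [left|].
by exists 1; do 2!eexists; rewrite mul1r; split; [right|].
Qed.

End MagicTorus.

Lemma re_ex_table m (T : table m m) : (1 < m)%N -> re (ex_table T) = T.
Proof.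
move=> m_gt1; apply/matrixP=> i j; rewrite !mxE.
have jlt : (j < m)%N by have := ltn_ord j; rewrite [X in (_ < X)%N]Zp_cast.
rewrite val_Zp_nat; last by lia.
rewrite modn_small; last by lia.
by rewrite oddM /= mul2n doubleK natr_Zp.
Qed.

(** As the shifts are consecutive, [(i, j)] to [(j - s i, j - (s + 1) i)] has determinant of
    absolute value [1], so the index pairs [(k, 0)] and [(0, k)] both occur; there the normalisation
    isolates one sequence. *)
Lemma circ_inj m s (a b a' b' : {ffun 'Z_m -> int}) :
    a 0 = a' 0 -> b 0 = b' 0 ->
    circ a s + circ b s.+1 = circ a' s + circ b' s.+1 ->
  a = a' /\ b = b'.
Proof.
move=> a0 b0 E.
have {}E (i j : 'Z_m) : a (j - s%:R * i) + b (j - s.+1%:R * i)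
                      = a' (j - s%:R * i) + b' (j - s.+1%:R * i).
  by have := congr1 (fun A : table m m => A i j) E; rewrite !mxE.
split; apply/ffunP=> k.
  have := E k (s.+1%:R * k); rewrite subrr b0 => /addIr.
  by rewrite (_ : _ - _ = k) //; ring.
have := E (- k) (- (s%:R * k)); rewrite mulrN opprK addNr a0 => /addrI.
by rewrite (_ : _ - _ = k) //; ring.
Qed.

Theorem theorem3p5 (m : nat) (ell : 'Z_m * 'Z_(2 * m) -> int) :
  (3 <= m)%N -> odd m ->
  distance_magic (torus m (2 * m)) ell ->
  ell (0, 0) = 1 ->
  (exists! ab : {ffun 'Z_m -> int} * {ffun 'Z_m -> int},
     admissible ab.1 ab.2 /\
     re (label_table ell)
       = circ ab.1 ((m - 1) %/ 2) + circ ab.2 ((m + 1) %/ 2))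
  /\ (forall a b : {ffun 'Z_m -> int}, admissible a b ->
       (re (label_table ell) = circ a ((m - 1) %/ 2) + circ b ((m + 1) %/ 2)
        <->
        label_table ell
          = ex_table (circ a ((m - 1) %/ 2) + circ b ((m + 1) %/ 2)))).
Proof.
move=> m_ge3 m_odd magic ell1.
split; last first.
  move=> a b _; split=> [<-|->]; first by rewrite ex_re_label_table.
  by rewrite re_ex_table //; lia.
have adm := diag_admissible m_ge3 m_odd magic ell1.
have reE := re_label_table m_ge3 m_odd magic.
exists (diag_a ell, diag_b ell); split=> // -[a b] /= [adm'].
have [_ _ a0 b0 _] := adm; have [_ _ a0' b0' _] := adm'.
rewrite reE (_ : (m + 1) %/ 2 = ((m - 1) %/ 2).+1)%N; last by lia.
by case/circ_inj=> [| |-> ->]; rewrite ?a0 ?b0.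
Qed.
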